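(* If $r$ is an integer, then $$\int_0^{\pi/2}\frac{\tan^2 x}{1+L_{2r}\tan^2x+\tan^4x}\,dx = \begin{cases}\dfrac{\pi}{2}\,\dfrac{1}{F_r\sqrt5\,(F_r\sqrt5+2)}, & \text{if } r \text{ is odd};\\[2mm] \dfrac{\pi}{2}\,\dfrac{1}{L_r(L_r+2)}, & \text{if } r\text{ is even}.\end{cases}$$
   Context: For $n\in\mathbb Z$, with $\alpha=(1+\sqrt5)/2$ and $\beta=(1-\sqrt5)/2$, the Fibonacci and Lucas numbers are $F_n=(\alpha^n-\beta^n)/(\alpha-\beta)$ and $L_n=\alpha^n+\beta^n$ (so $F_{-n}=(-1)^{n-1}F_n$, $L_{-n}=(-1)^nL_n$). *)

(* Defs.v *)
From Stdlib Require Import Reals ZArith.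
Open Scope R_scope.

Definition alpha : R := (1 + sqrt 5) / 2.
Definition beta : R := (1 - sqrt 5) / 2.

(* Real-valued and indexed by all integers, hence the integer power powerRZ. *)
Definition fibonacci (n : Z) : R :=
  (powerRZ alpha n - powerRZ beta n) / (alpha - beta).

Definition lucas (n : Z) : R := powerRZ alpha n + powerRZ beta n.

(* Main.v *)
(** Since [alpha * beta = -1], put [p = alpha^r > 0] and [S = p + 1/p >= 2]; then
    [lucas (2r) = S^2 - 2], while [S] is [lucas r] for even [r] and
    [sqrt 5 * fibonacci r] for odd [r].  Multiplying through by [cos^4 x], the
    integrand becomes [sin^2 2x / (4 + (S^2 - 4) sin^2 2x)], which has an explicit
    antiderivative, smooth on all of [[0, PI/2]]. *)

Require Import Defs.
From Stdlib Require Import Reals ZArith Lra.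
From Coquelicot Require Import Coquelicot.
Open Scope R_scope.

Lemma double_angle_denominator_pos (S x : R) (hS : 2 <= S) :
  0 < 4 + (S ^ 2 - 4) * sin (2 * x) ^ 2.
Proof.
assert (0 <= (S ^ 2 - 4) * sin (2 * x) ^ 2); [|lra].
apply Rmult_le_pos; [nra | apply pow2_ge_0].
Qed.

Lemma tan_quartic_double_angle (S x : R) (hS : 2 <= S) (hx : cos x <> 0) :
  tan x ^ 2 / (1 + (S ^ 2 - 2) * tan x ^ 2 + tan x ^ 4)
  = sin (2 * x) ^ 2 / (4 + (S ^ 2 - 4) * sin (2 * x) ^ 2).
Proof.
pose proof (double_angle_denominator_pos S x hS) as Hd.
assert (H1 : sin x ^ 2 + cos x ^ 2 = 1)
  by (generalize (sin2_cos2 x); unfold Rsqr; lra).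
rewrite sin_2a in *; unfold tan.
(* Writing the constant 4 as [4 * (sin x ^ 2 + cos x ^ 2) ^ 2] makes the denominator a quartic form
   in [sin x] and [cos x], namely [4 * cos x ^ 4] times the one on the left-hand side. *)
assert (He : 4 + (S ^ 2 - 4) * (2 * sin x * cos x) ^ 2
  = 4 * (cos x ^ 4 + (S ^ 2 - 2) * (sin x ^ 2 * cos x ^ 2) + sin x ^ 4)).
{ replace 4 with (4 * (sin x ^ 2 + cos x ^ 2) ^ 2) at 1 by (rewrite H1; ring).
  ring. }
rewrite He in *.
field; repeat split; nra.
Qed.

(* [theta + atan ((b - a) sin theta cos theta / (a cos^2 theta + b sin^2 theta))] is
   the continuous branch of [atan (b / a * tan theta)]; here [a = 2], [b = S],
   [theta = 2 * x]. *)
Lemma is_derive_atan_branch (S x : R) (hS : 2 <= S) :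
  is_derive (fun x => 2 * x + atan ((S - 2) * (sin (2 * x) * cos (2 * x))
                               / (2 * cos (2 * x) ^ 2 + S * sin (2 * x) ^ 2)))
    x (4 * S / (4 + (S ^ 2 - 4) * sin (2 * x) ^ 2)).
Proof.
pose proof (double_angle_denominator_pos S x hS) as Hd.
assert (H1 : cos (2 * x) ^ 2 = 1 - sin (2 * x) ^ 2)
  by (generalize (sin2_cos2 (2 * x)); unfold Rsqr; lra).
assert (HD : 0 < 2 * cos (2 * x) ^ 2 + S * sin (2 * x) ^ 2)
  by (generalize (pow2_ge_0 (sin (2 * x))); nra).
auto_derive; [simpl in HD; lra|].
set (s := sin (2 * x)) in *; set (c := cos (2 * x)) in *.
(* This sum is the denominator left by [1 + u ^ 2] for the [atan] argument [u]. It factors as the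
   squared modulus of [(2c + iSs)(c - is)]. *)
assert (HN : (2 * c ^ 2 + S * s ^ 2) ^ 2 + ((S - 2) * (s * c)) ^ 2
   = 4 + (S ^ 2 - 4) * s ^ 2).
{ replace ((2 * c ^ 2 + S * s ^ 2) ^ 2 + ((S - 2) * (s * c)) ^ 2)
    with ((4 * c ^ 2 + S ^ 2 * s ^ 2) * (c ^ 2 + s ^ 2)) by ring.
  rewrite H1; ring. }
rewrite <- HN in *.
field_simplify_eq; [|repeat split; nra].
ring [H1].
Qed.

Lemma is_RInt_double_angle (S : R) (hS : 2 <= S) :
  is_RInt (fun x => sin (2 * x) ^ 2 / (4 + (S ^ 2 - 4) * sin (2 * x) ^ 2))
    0 (PI / 2) (PI / 2 * (1 / (S * (S + 2)))).
Proof.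
assert (Hs : sin (2 * (PI / 2)) = 0)
  by (replace (2 * (PI / 2)) with PI by field; apply sin_PI).
assert (Hc : forall x, continuous
  (fun x => sin (2 * x) ^ 2 / (4 + (S ^ 2 - 4) * sin (2 * x) ^ 2)) x).
{ intros x; apply (ex_derive_continuous (V := R_NormedModule)).
  generalize (double_angle_denominator_pos S x hS); intros H.
  auto_derive; simpl in *; lra. }
(* The general antiderivative divides by [S ^ 2 - 4]; at [S = 2], which arises from [r = 0], the
   integrand is just [sin (2 * x) ^ 2 / 4]. *)
destruct (Req_dec S 2) as [-> | hne].
- pose (G := fun x => x / 8 - sin (2 * x) * cos (2 * x) / 16).
  replace (PI / 2 * (1 / (2 * (2 + 2)))) with (minus (G (PI / 2)) (G 0)).
  2:{ unfold G, minus, plus, opp; simpl; rewrite Hs, Rmult_0_r, sin_0; field. }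
  apply (is_RInt_derive (V := R_CompleteNormedModule)); [intros x _ | auto].
  unfold G; auto_derive; [easy|].
  generalize (sin2_cos2 (2 * x)); unfold Rsqr; intros H.
  replace (4 + (2 ^ 2 - 4) * sin (2 * x) ^ 2) with 4 by ring.
  nra.
(* With [D] the denominator, the integrand equals [(1 - 4 / D) / (S ^ 2 - 4)], and the [atan] branch
   has derivative [4 * S / D]. At both endpoints [sin (2 * x) = 0], so only the linear terms
   contribute. *)
- pose (G := fun x => (x - / S * (2 * x
      + atan ((S - 2) * (sin (2 * x) * cos (2 * x))
              / (2 * cos (2 * x) ^ 2 + S * sin (2 * x) ^ 2)))) / (S ^ 2 - 4)).
  replace (PI / 2 * (1 / (S * (S + 2)))) with (minus (G (PI / 2)) (G 0)).
  2:{ unfold G, minus, plus, opp; simpl.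
      rewrite Hs, Rmult_0_r, sin_0; unfold Rdiv.
      rewrite !Rmult_0_l, !Rmult_0_r, !Rmult_0_l, atan_0.
      field; repeat split; nra. }
  apply (is_RInt_derive (V := R_CompleteNormedModule)); [intros x _ | auto].
  pose proof (double_angle_denominator_pos S x hS) as Hd.
  pose proof (is_derive_atan_branch S x hS) as Hb.
  unfold G.
  evar_last.
  { apply (is_derive_ext (fun x => scal (/ (S ^ 2 - 4)) (minus x (scal (/ S) (2 * x
      + atan ((S - 2) * (sin (2 * x) * cos (2 * x))
              / (2 * cos (2 * x) ^ 2 + S * sin (2 * x) ^ 2))))))).
    { intros t; unfold scal, minus, plus, opp; simpl; unfold mult; simpl.
      unfold Rdiv; ring. }
    apply is_derive_scal, @is_derive_minus; [apply is_derive_id|].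
    apply is_derive_scal, Hb. }
  unfold scal, minus, plus, opp, one; simpl; unfold mult; simpl.
  simpl in Hd. field; repeat split; nra.
Qed.

Lemma is_RInt_tan_quartic (S : R) (hS : 2 <= S) :
  is_RInt (fun x => tan x ^ 2 / (1 + (S ^ 2 - 2) * tan x ^ 2 + tan x ^ 4))
    0 (PI / 2) (PI / 2 * (1 / (S * (S + 2)))).
Proof.
(* Agreement on the open interval suffices, so the value of [tan] at its pole [PI / 2] is
   irrelevant. *)
eapply is_RInt_ext; [|exact (is_RInt_double_angle S hS)].
pose proof PI_RGT_0.
rewrite Rmin_left, Rmax_right by lra.
intros x Hx; symmetry; apply tan_quartic_double_angle; [easy|].
apply Rgt_not_eq, cos_gt_0; lra.
Qed.

Lemma alpha_pos : 0 < alpha.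
Proof. unfold alpha; generalize (sqrt_pos 5); lra. Qed.

Lemma beta_alpha : beta = -1 * / alpha.
Proof.
pose proof alpha_pos.
apply (Rmult_eq_reg_r alpha); [|lra].
rewrite Rmult_assoc, Rinv_l by lra.
unfold alpha, beta; generalize (sqrt_sqrt 5); nra.
Qed.

Lemma powerRZ_opp1 (n : Z) : powerRZ (-1) n = if Z.odd n then -1 else 1.
Proof.
assert (H2 : forall k, powerRZ (-1) (2 * k) = 1).
{ intros k; rewrite <- Z.add_diag, powerRZ_add, <- powerRZ_mult by lra.
  replace (-1 * -1) with 1 by ring.
  apply powerRZ_R1. }
rewrite (Z.div2_odd n) at 1.
rewrite powerRZ_add, H2 by lra.
destruct (Z.odd n); simpl; ring.
Qed.

(** Eliminates [beta], leaving expressions in powers of [alpha] and a parity sign. *)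
Lemma powerRZ_beta (n : Z) :
  powerRZ beta n = (if Z.odd n then -1 else 1) * / powerRZ alpha n.
Proof.
rewrite beta_alpha, powerRZ_mult, powerRZ_opp1, powerRZ_inv'; easy.
Qed.

Theorem corollary5 (r : Z) :
  is_RInt (fun x : R =>
      (tan x) ^ 2 / (1 + lucas (2 * r)%Z * (tan x) ^ 2 + (tan x) ^ 4))
    0 (PI / 2)
    (if Z.odd r
     then PI / 2 * (1 / (fibonacci r * sqrt 5 * (fibonacci r * sqrt 5 + 2)))
     else PI / 2 * (1 / (lucas r * (lucas r + 2)))).
Proof.
set (p := powerRZ alpha r).
assert (hp : 0 < p) by apply powerRZ_lt, alpha_pos.
set (S := p + / p).
assert (hS : 2 <= S).
{ unfold S; replace (p + / p) with (2 + (p - 1) ^ 2 * / p) by (field; lra).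
  assert (0 <= (p - 1) ^ 2 * / p); [|lra].
  apply Rmult_le_pos; [apply pow2_ge_0 | apply Rlt_le, Rinv_0_lt_compat, hp]. }
assert (hL : lucas (2 * r) = S ^ 2 - 2).
{ unfold lucas; rewrite powerRZ_beta, Z.odd_mul.
  rewrite <- Z.add_diag, powerRZ_add by (generalize alpha_pos; lra).
  fold p; unfold S; simpl; field; lra. }
(* For odd [r] the power of [beta] is [- / p], so the difference in [fibonacci] turns into
   [p + / p]; for even [r] the sum in [lucas] is already that. *)
assert (hv : (if Z.odd r then fibonacci r * sqrt 5 else lucas r) = S).
{ assert (0 < sqrt 5) by (apply sqrt_lt_R0; lra).
  unfold fibonacci, lucas; rewrite powerRZ_beta; fold p.
  replace (alpha - beta) with (sqrt 5) by (unfold alpha, beta; field).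
  unfold S; destruct (Z.odd r); field; lra. }
rewrite hL.
replace (if Z.odd r then _ else _) with (PI / 2 * (1 / (S * (S + 2)))).
- exact (is_RInt_tan_quartic S hS).
- rewrite <- hv; destruct (Z.odd r); reflexivity.
Qed.
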